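(* There exists a symmetric generating set $T=\{t_1,\dots,t_{32}\}$ (consisting of involutions) for $J_2$ with control group $2^{1+4}:A_5$. That is, there exist a transitive subgroup $N\le S_{32}$ with $N\cong 2^{1+4}:A_5$ and a surjective homomorphism $\varphi:2^{\star 32}:N\to J_2$ such that $\varphi|_N$ is an isomorphism onto its image, the elements $\varphi(t_1),\dots,\varphi(t_{32})$ are distinct involutions, and $J_2=\langle\varphi(t_1),\dots,\varphi(t_{32})\rangle$.
   Context: $J_2$ is the second Janko group, the sporadic simple group of order $604800$. $2^{1+4}:A_5$ denotes the maximal subgroup of $J_2$ of that shape (order $1920$), a split extension of an extraspecial group of order $32$ by $A_5$. $2^{\star 32}=\langle t_1,\dots,t_{32}\mid t_i^2=1\rangle$ is the free product of 32 copies of $C_2$. For a transitive subgroup $N\le S_{32}$ (the control group), the progenitor $2^{\star 32}:N$ is the semidirect product in which $N$ permutes the $t_i$ by $n^{-1}t_in=t_{i^n}$. *)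

(* Defs.v *)
From HB Require Import structures.
From mathcomp Require Import all_boot ssrAC all_fingroup all_solvable.

Set Implicit Arguments.
Unset Strict Implicit.
Unset Printing Implicit Defensive.

Local Open Scope group_scope.

(* Standard generators of J2 on the 100 vertices of the Hall-Janko graph, as  *)
(* image tables: a in class 2B, b in class 3B, ab of order 7, ababb of order  *)
(* 12. Vertex 0 is adjacent to 1, .., 36. By card_J2 and simple_J2 below the  *)
(* generated group is simple of order 604800; such a group is unique up to    *)
(* isomorphism (Hall and Wales).                                              *)
Definition j2_a_table : seq nat :=
  [::
    24; 88; 69; 11; 32; 50; 94; 70; 58; 47; 78; 3; 18; 21; 29; 86; 82; 73; 12; 92;
    22; 13; 20; 54; 0; 95; 80; 65; 81; 14; 39; 85; 4; 83; 36; 77; 34; 59; 74; 30;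
    57; 61; 84; 48; 72; 52; 93; 9; 43; 98; 5; 75; 45; 97; 23; 89; 60; 40; 8; 37;
    56; 41; 68; 64; 63; 27; 91; 87; 62; 2; 7; 99; 44; 17; 38; 51; 96; 35; 10; 90;
    26; 28; 16; 33; 42; 31; 15; 67; 1; 55; 79; 66; 19; 46; 6; 25; 76; 53; 49; 71]%N.

Definition j2_b_table : seq nat :=
  [::
    95; 69; 91; 71; 22; 65; 57; 24; 81; 77; 89; 44; 14; 86; 17; 56; 18; 12; 79; 51;
    88; 60; 31; 23; 63; 72; 43; 2; 67; 40; 46; 4; 83; 33; 53; 21; 78; 92; 32; 30;
    48; 73; 11; 80; 42; 75; 39; 34; 29; 58; 6; 66; 20; 47; 13; 49; 68; 50; 55; 87;
    35; 61; 62; 7; 59; 90; 19; 85; 15; 82; 10; 96; 93; 94; 37; 99; 0; 97; 98; 16;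
    26; 84; 1; 38; 8; 28; 54; 64; 52; 70; 5; 27; 74; 25; 41; 76; 3; 9; 36; 45]%N.

Definition table_fun (s : seq nat) (x : 'I_100) : 'I_100 := inord (nth 0 s x).

Lemma table_fun_inj (s : seq nat) :
  [&& size s == 100, uniq s & all (fun i => i < 100) s] ->
  injective (table_fun s).
Proof.
case/and3P=> /eqP sz_s uniq_s /allP lt_s x y /(congr1 val) /=.
have lt_nth (z : 'I_100) : nth 0 s z < 100 by rewrite lt_s ?mem_nth ?sz_s.
rewrite !inordK //= => /eqP; rewrite nth_uniq ?sz_s //.
by move/eqP/val_inj.
Qed.

Lemma j2_a_inj : injective (table_fun j2_a_table).
Proof. exact: table_fun_inj. Qed.

Lemma j2_b_inj : injective (table_fun j2_b_table).
Proof. exact: table_fun_inj. Qed.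

Definition j2_a : 'S_100 := perm j2_a_inj.
Definition j2_b : 'S_100 := perm j2_b_inj.

Definition J2 : {group 'S_100} := <<[set j2_a; j2_b]>>%G.

(* 2^{*n}: reduced words in the letters 'I_n, multiplied by concatenation     *)
(* followed by cancellation of adjacent equal letters.                        *)
Section FreeProductC2.
Variable n : nat.
Implicit Types (i j : 'I_n) (u v w : seq 'I_n) (s : 'S_n).

Definition reduced w := sorted (fun i j => i != j) w.

Record freeC2 := FreeC2 {fword : seq 'I_n; _ : reduced fword}.

HB.instance Definition _ := [isSub for fword].
HB.instance Definition _ := [Choice of freeC2 by <:].

Definition letter_mul i w :=
  if w is j :: w' then if i == j then w' else i :: w else [:: i].

Definition word_mul u v := foldr letter_mul v u.

Lemma letter_mul_reduced i w : reduced w -> reduced (letter_mul i w).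
Proof.
case: w => [|j w] //=; case: eqVneq => [_ | nij] jw; first exact: path_sorted jw.
by rewrite /= nij.
Qed.

Lemma word_mul_reduced u v : reduced v -> reduced (word_mul u v).
Proof. by move=> rv; elim: u => //= i u; apply: letter_mul_reduced. Qed.

Lemma letter_mulK i w : reduced w -> letter_mul i (letter_mul i w) = w.
Proof.
case: w => [|j w] /=; first by rewrite eqxx.
case: eqVneq => [-> | _] /=; last by rewrite eqxx.
by case: w => //= k w /andP[/negPf->].
Qed.

Lemma word_mul_letter i u w : reduced u -> reduced w ->
  word_mul (letter_mul i u) w = letter_mul i (word_mul u w).
Proof.
case: u => [|j u] //= _ rw; case: eqVneq => //= ->.
by rewrite letter_mulK ?word_mul_reduced.
Qed.

Lemma word_mulA u v w : reduced v -> reduced w ->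
  word_mul u (word_mul v w) = word_mul (word_mul u v) w.
Proof.
move=> rv rw; elim: u => //= i u ->.
by rewrite word_mul_letter ?word_mul_reduced.
Qed.

Lemma word_mulw0 u : reduced u -> word_mul u [::] = u.
Proof.
elim: u => //= i u IHu ru; rewrite IHu; last exact: path_sorted ru.
by case: u ru {IHu} => //= j u /andP[/negPf->].
Qed.

Lemma reduced_rev u : reduced (rev u) = reduced u.
Proof.
by rewrite /reduced rev_sorted; apply: eq_sorted => i j; rewrite eq_sym.
Qed.

Lemma word_mulV u w : reduced w -> word_mul (rev u) (word_mul u w) = w.
Proof.
elim: u w => //= i u IHu w rw.
rewrite rev_cons /word_mul foldr_rcons -!/(word_mul _ _).
by rewrite letter_mulK ?word_mul_reduced // IHu.
Qed.

Definition freeC2_one := @FreeC2 [::] isT.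
Definition freeC2_mul (x y : freeC2) :=
  FreeC2 (word_mul_reduced (fword x) (valP y)).
Definition freeC2_inv (x : freeC2) :=
  FreeC2 (etrans (reduced_rev (fword x)) (valP x)).

Fact freeC2_mulA : associative freeC2_mul.
Proof. by move=> x y z; apply/val_inj/word_mulA; apply: valP. Qed.

Fact freeC2_mul1g : left_id freeC2_one freeC2_mul.
Proof. by move=> x; apply: val_inj. Qed.

Fact freeC2_mulg1 : right_id freeC2_one freeC2_mul.
Proof. by move=> x; apply/val_inj/word_mulw0/valP. Qed.

Fact freeC2_mulVg : left_inverse freeC2_one freeC2_inv freeC2_mul.
Proof.
move=> x; apply: val_inj => /=.
by rewrite -{2}(word_mulw0 (valP x)) word_mulV.
Qed.

Fact freeC2_mulgV : right_inverse freeC2_one freeC2_inv freeC2_mul.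
Proof.
move=> x; rewrite -{1}[x](_ : freeC2_inv (freeC2_inv x) = x) ?freeC2_mulVg //.
by apply: val_inj; rewrite /= revK.
Qed.

HB.instance Definition _ := isGroup.Build freeC2
  freeC2_mulA freeC2_mul1g freeC2_mulg1 freeC2_mulVg freeC2_mulgV.

Definition freeC2_gen i : freeC2 := @FreeC2 [:: i] isT.

Lemma reduced_map s w : reduced (map s w) = reduced w.
Proof.
rewrite /reduced sorted_map; apply: eq_sorted => i j /=.
by rewrite (inj_eq perm_inj).
Qed.

Definition freeC2_act (x : freeC2) s : freeC2 :=
  FreeC2 (etrans (reduced_map s (fword x)) (valP x)).

Lemma freeC2_act1 x : freeC2_act x 1 = x.
Proof.
by apply: val_inj; rewrite /= -[RHS]map_id; apply: eq_map => i; rewrite perm1.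
Qed.

Lemma freeC2_actM x s t : freeC2_act x (s * t) = freeC2_act (freeC2_act x s) t.
Proof.
by apply: val_inj; rewrite /= -map_comp; apply: eq_map => i; rewrite /= permM.
Qed.

Lemma freeC2_act_mul x y s :
  freeC2_act (x * y) s = freeC2_act x s * freeC2_act y s.
Proof.
apply: val_inj => /=; elim: (fword x) => //= i u <-.
by case: word_mul => //= j w; rewrite (inj_eq perm_inj); case: eqP.
Qed.

Lemma freeC2_act_one s : freeC2_act 1 s = 1.
Proof. exact: val_inj. Qed.

End FreeProductC2.

(* The progenitor 2^{*n} : N; the pair (s, x) stands for the product s x. *)
Section Progenitor.
Variables (n : nat) (N : {group 'S_n}).

Record progenitor := Progenitor {prog_ctl : [subg N]; prog_free : freeC2 n}.

Definition prog_pair (p : progenitor) := (prog_ctl p, prog_free p).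
Definition pair_prog p := Progenitor p.1 p.2.

Fact prog_pairK : cancel prog_pair pair_prog.
Proof. by case. Qed.

HB.instance Definition _ := Choice.copy progenitor (can_type prog_pairK).

Definition prog_one := Progenitor 1 1.
Definition prog_mul p q :=
  Progenitor (prog_ctl p * prog_ctl q)
             (freeC2_act (prog_free p) (sgval (prog_ctl q)) * prog_free q).
Definition prog_inv p :=
  Progenitor (prog_ctl p)^-1
             (freeC2_act (prog_free p)^-1 (sgval (prog_ctl p)^-1)).

Fact prog_mulA : associative prog_mul.
Proof.
case=> [s x] [t y] [r z]; congr Progenitor; rewrite /= ?mulgA //.
by rewrite freeC2_act_mul freeC2_actM.
Qed.

Fact prog_mul1g : left_id prog_one prog_mul.
Proof. by case=> [s x]; congr Progenitor; rewrite /= ?freeC2_act_one mul1g. Qed.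

Fact prog_mulg1 : right_id prog_one prog_mul.
Proof. by case=> [s x]; congr Progenitor; rewrite /= ?freeC2_act1 mulg1. Qed.

Fact prog_mulVg : left_inverse prog_one prog_inv prog_mul.
Proof.
case=> [s x]; congr Progenitor; rewrite /= ?mulVg //.
by rewrite -freeC2_actM mulVg freeC2_act1 mulVg.
Qed.

Fact prog_mulgV : right_inverse prog_one prog_inv prog_mul.
Proof.
case=> [s x]; congr Progenitor; rewrite /= ?mulgV //.
by rewrite -freeC2_act_mul mulgV freeC2_act_one.
Qed.

HB.instance Definition _ := isGroup.Build progenitor
  prog_mulA prog_mul1g prog_mulg1 prog_mulVg prog_mulgV.

Definition prog_N (s : [subg N]) : progenitor := Progenitor s 1.
Definition prog_t (i : 'I_n) : progenitor := Progenitor 1 (freeC2_gen i).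

Lemma prog_tJ (s : [subg N]) i : prog_t i ^ prog_N s = prog_t (sgval s i).
Proof.
rewrite /conjg; congr Progenitor; rewrite /= ?mul1g ?mulVg //.
by apply: val_inj.
Qed.

End Progenitor.

Definition shape_2p1p4_A5 (gT : finGroupType) (M : {group gT}) :=
  exists E A : {group gT},
    [/\ E ><| A = M, extraspecial E, #|E| = 32 & A \isog 'Alt_('I_5)].

(* J2 has a single class of maximal subgroups of this shape, so this fixes N  *)
(* up to isomorphism.                                                         *)
Definition is_2p1p4_A5 (gT : finGroupType) (N : {group gT}) :=
  exists M : {group 'S_100},
    [/\ maximal M J2, shape_2p1p4_A5 M & N \isog M].

(* card_J2 and simple_J2: a stabiliser chain on permutation tables.           *)

Definition tab (g : 'S_100) : seq nat := [seq val (g x) | x <- enum 'I_100].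
Definition idt := iota 0 100.
Definition compt (s t : seq nat) := [seq nth 0 t i | i <- s].
Definition invt (t : seq nat) := [seq index i t | i <- iota 0 100].

Lemma nth_tab g (x : 'I_100) : nth 0 (tab g) x = g x.
Proof. by rewrite (nth_map x) ?size_enum_ord // nth_ord_enum. Qed.

Lemma size_tab g : size (tab g) = 100.
Proof. by rewrite size_map size_enum_ord. Qed.

Lemma tab_inj : injective tab.
Proof. by move=> g h e; apply/permP=> x; apply: val_inj; rewrite /= -!nth_tab e. Qed.

Lemma tab1 : tab 1 = idt.
Proof.
rewrite /idt -val_enum_ord /tab.
by apply: eq_map => x; rewrite perm1.
Qed.

Lemma tabM g h : tab (g * h) = compt (tab g) (tab h).
Proof.
rewrite /compt [tab (g * h)]/tab [tab g]/tab -map_comp; apply: eq_map => x /=.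
by rewrite nth_tab permM.
Qed.

Lemma tabV g : tab g^-1 = invt (tab g).
Proof.
rewrite /invt -val_enum_ord -map_comp; apply: eq_map => x /=.
have -> : val x = nth 0 (tab g) (g^-1 x) by rewrite nth_tab permKV.
rewrite index_uniq ?size_tab //.
by rewrite map_inj_uniq ?enum_uniq // => y z /val_inj/perm_inj.
Qed.

Lemma tab_j2_a : tab j2_a = j2_a_table.
Proof.
apply: (@eq_from_nth _ 0) => [|i]; rewrite size_tab // => lti.
have := nth_tab j2_a (Ordinal lti); rewrite /= => ->; rewrite permE /= inordK //.
by move: i lti; apply/(@all_nthP _ (fun i => i < 100) j2_a_table 0).
Qed.

Lemma tab_j2_b : tab j2_b = j2_b_table.
Proof.
apply: (@eq_from_nth _ 0) => [|i]; rewrite size_tab // => lti.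
have := nth_tab j2_b (Ordinal lti); rewrite /= => ->; rewrite permE /= inordK //.
by move: i lti; apply/(@all_nthP _ (fun i => i < 100) j2_b_table 0).
Qed.

(* Stabiliser chains: an entry (i, (tab u, tab u^-1)) of a transversal at the *)
(* base point x records an element u with u x = i. *)
Definition tr_entry := (nat * (seq nat * seq nat))%type.

Definition tr_add (UQ : seq tr_entry * seq tr_entry) (v : tr_entry) :=
  if has (fun w => w.1 == v.1) UQ.1 then UQ else (rcons UQ.1 v, rcons UQ.2 v).

Definition tr_mul (v : tr_entry) (s : seq nat * seq nat) : tr_entry :=
  (nth 0 s.1 v.1, (compt v.2.1 s.1, compt s.2 v.2.2)).

Fixpoint tr_grow k (S : seq (seq nat * seq nat)) UQ : seq tr_entry :=
  if k is k'.+1 then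
    if UQ.2 is u :: Q then
      tr_grow k' S (foldl tr_add (UQ.1, Q) [seq tr_mul u s | s <- S])
    else UQ.1
  else UQ.1.

Definition transv (S : seq (seq nat)) (x : nat) : seq tr_entry :=
  let e := (x, (idt, idt)) in
  tr_grow 101 [seq (s, invt s) | s <- S] ([:: e], [:: e]).

Definition tr_find (U : seq tr_entry) (y : nat) : tr_entry :=
  nth (y, (idt, idt)) U (find (fun w => w.1 == y) U).

Definition stabt (S : seq (seq nat)) (x : nat) := [seq s <- S | nth 0 s x == x].

Fixpoint chain (S : seq (seq nat)) (bs : seq nat) :=
  if bs is x :: r then (x, transv S x) :: chain (stabt S x) r else [::].

Fixpoint sift (lv : seq (nat * seq tr_entry)) (t : seq nat) :=
  if lv is p :: r then sift r (compt t (tr_find p.2 (nth 0 t p.1)).2.2)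
  else t == idt.

Definition tr_ok (U : seq tr_entry) (S : seq (seq nat)) lv :=
  all (fun w : tr_entry => all (fun s =>
    let y := nth 0 s w.1 in
    has (fun v : tr_entry => v.1 == y) U &&
    sift lv (compt (compt w.2.1 s) (tr_find U y).2.2)) S) U.

Fixpoint chain_ok (S : seq (seq nat)) (bs : seq nat) :=
  if bs is x :: r then
    let U := transv S x in
    [&& uniq [seq w.1 | w <- U], (x, (idt, idt)) \in U,
        tr_ok U S (chain (stabt S x) r) & chain_ok (stabt S x) r]
  else all (pred1 idt) S.

Definition gent (S : seq (seq nat)) : {group 'S_100} :=
  <<[set g | tab g \in S]>>%G.

Definition validt (S : seq (seq nat)) := {in S, forall s, exists g, tab g = s}.

Lemma validt_stab S x : validt S -> validt (stabt S x).
Proof. by move=> vS s; rewrite mem_filter => /andP[_ /vS]. Qed.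

Lemma gent_stab S x : gent (stabt S x) \subset gent S.
Proof.
by apply: genS; apply/subsetP=> g; rewrite !inE mem_filter => /andP[].
Qed.

Lemma gent_stab_fix S (x : 'I_100) g : g \in gent (stabt S x) -> g x = x.
Proof.
suff /subsetP sH: gent (stabt S x) \subset 'C[x | 'P].
  by move/sH/astab1P.
rewrite gen_subG; apply/subsetP=> h; rewrite inE mem_filter => /andP[/eqP hx _].
by apply/astab1P; apply: val_inj; rewrite /= /aperm -nth_tab.
Qed.

Definition tr_in (G : {group 'S_100}) (x : 'I_100) (w : tr_entry) :=
  exists2 g, g \in G & w = (val (g x), (tab g, tab g^-1)).

Lemma tr_in1 G (x : 'I_100) : tr_in G x (val x, (idt, idt)).
Proof. by exists 1; rewrite ?group1 // invg1 perm1 tab1. Qed.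

Lemma tr_in_mul S (x : 'I_100) w s : validt S -> s \in S ->
  tr_in (gent S) x w -> tr_in (gent S) x (tr_mul w (s, invt s)).
Proof.
move=> vS Ss [g Gg ->]; have [h hs] := vS s Ss; exists (g * h).
  by rewrite groupM // mem_gen // inE hs.
by rewrite -hs -tabV /tr_mul /= nth_tab permM invMg !tabM.
Qed.

Lemma transvP S (x : 'I_100) : validt S ->
  {in transv S x, forall w, tr_in (gent S) x w}.
Proof.
move=> vS; rewrite /transv.
set UQ := (X in tr_grow _ _ X).
have: {in UQ.1, forall w, tr_in (gent S) x w} /\ {in UQ.2, forall w, tr_in (gent S) x w}.
  by split=> w; rewrite mem_seq1 => /eqP->; apply: tr_in1.
elim: 101 UQ => [|k IHk] [U [|u Q]] [/= PU PQ] //.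
apply: IHk.
have Pu: tr_in (gent S) x u by apply: PQ; rewrite mem_head.
have {}PQ : {in Q, forall w, tr_in (gent S) x w}.
  by move=> w Qw; apply: PQ; rewrite inE Qw orbT.
have: {in [seq tr_mul u s | s <- [seq (s, invt s) | s <- S]],
         forall w, tr_in (gent S) x w}.
  by move=> _ /mapP[_ /mapP[s Ss ->] ->]; apply: tr_in_mul.
elim: map U Q PU PQ => [|v vs IHv] U Q PU PQ Pv; first by [].
rewrite /= [tr_add (U, Q) v]/tr_add /=.
have Pvs: {in vs, forall w, tr_in (gent S) x w}.
  by move=> w vs_w; apply: Pv; rewrite inE vs_w orbT.
have Pv0: tr_in (gent S) x v by apply: Pv; rewrite mem_head.
case: ifP => _; apply: IHv => // w; rewrite mem_rcons inE => /predU1P[-> //|].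
  exact: PU.
exact: PQ.
Qed.

Lemma tr_findP S (x : 'I_100) y : validt S ->
  exists2 g, g \in gent S & (tr_find (transv S x) y).2 = (tab g, tab g^-1).
Proof.
move=> vS; rewrite /tr_find.
set U := transv S x; set i := find _ _.
case: (ltnP i (size U)) => [lti | gei]; last first.
  by exists 1; rewrite ?group1 // nth_default //= invg1 tab1.
have [g Gg ->] := transvP vS (mem_nth (y, (idt, idt)) lti).
by exists g.
Qed.

Lemma siftP S bs g : validt S -> all (fun x => x < 100) bs ->
  sift (chain S bs) (tab g) -> g \in gent S.
Proof.
elim: bs S g => [|x bs IH] S g vS /=.
  by move=> _ /eqP; rewrite -tab1 => /tab_inj->; apply: group1.
case/andP=> ltx ltbs.
have [h Gh ->] := tr_findP (Ordinal ltx) (nth 0 (tab g) x) vS.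
rewrite -tabM /=; move/IH => /(_ (validt_stab vS) ltbs) => /(subsetP (gent_stab S x)).
by rewrite groupMr ?groupV.
Qed.

Lemma chain_okP S (x : 'I_100) r : validt S -> all (fun x => x < 100) r ->
    chain_ok S (val x :: r) ->
  'C_(gent S)[x | 'P] = gent (stabt S x) /\
  #|orbit 'P (gent S) x| = size (transv S x).
Proof.
move=> vS ltr; set S' := stabt S x; set U := transv S x.
case/and4P; rewrite -/U -/S' => uU U1 /allP okU _.
have UP := transvP vS : {in U, forall w, tr_in (gent S) x w}.
have decomp g : g \in gent S ->
    exists2 w, w \in U & exists2 u : 'S_100, w = (val (u x), (tab u, tab u^-1)) &
      g * u^-1 \in gent S'.
  case/gen_prodgP=> k [c Sc ->] {g}.
  elim: k c Sc => [|k IHk] c Sc.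
    exists (val x, (idt, idt)) => //; exists 1.
      by rewrite invg1 perm1 tab1.
    by rewrite big_ord0 mul1g groupV group1.
  rewrite big_ord_recr /=.
  have [w Uw [u def_w Hu]] := IHk _ (fun i => Sc (widen_ord (leqnSn k) i)).
  have:= Sc ord_max; set s := c ord_max; rewrite inE => Ss.
  have /allP/(_ _ Ss) := okU _ Uw; case/andP.
  rewrite /tr_find; set y := nth 0 _ _; set i := find _ _.
  rewrite has_find => lti.
  have Uv := mem_nth (y, (idt, idt)) lti; have := UP _ Uv.
  case=> v Gv def_v; rewrite def_v def_w /= -!tabM.
  move/(siftP (validt_stab vS) ltr) => Hs.
  exists (nth (y, (idt, idt)) U i) => //; exists v => //.
  have -> : forall p, p * s * v^-1 = p * u^-1 * (u * s * v^-1).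
    by move=> p; rewrite -!mulgA mulKg.
  by rewrite groupM.
have inS' := gent_stab_fix (S := S).
split.
  apply/eqP; rewrite eqEsubset subsetI gent_stab /=; apply/andP; split; last first.
    by apply/subsetP=> g Hg; apply/astab1P; apply: inS'.
  apply/subsetP=> g /setIP[Gg /astab1P gx].
  have [w Uw [u def_w Hu]] := decomp g Gg.
  have ux: u x = x.
    have := inS' x _ Hu; rewrite permM.
    have -> : g x = x by exact: gx.
    by move=> e; rewrite -{1}e permKV.
  have: w = (val x, (idt, idt)).
    have nth_pt v : v \in U -> nth 0 [seq w.1 | w <- U] (index v U) = v.1.
      by move=> Uv; rewrite (nth_map w) ?index_mem // nth_index.
    have: nth 0 [seq w.1 | w <- U] (index w U)
        == nth 0 [seq w.1 | w <- U] (index (val x, (idt, idt)) U).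
      by rewrite !nth_pt // def_w /= ux.
    rewrite nth_uniq ?size_map ?index_mem // => /eqP.
    by move/(congr1 (nth w U)); rewrite !nth_index.
  rewrite def_w => -[_ + _]; rewrite -tab1 => /tab_inj u1.
  by move: Hu; rewrite u1 invg1 mulg1.
have uo: uniq [seq inord w.1 : 'I_100 | w <- U].
  have -> : [seq inord w.1 : 'I_100 | w <- U] = [seq inord i | i <- [seq w.1 | w <- U]].
    by rewrite -map_comp.
  rewrite map_inj_in_uniq // => i j /mapP[w /UP[g _ ->] ->] /mapP[v /UP[h _ ->] ->] /=.
  by rewrite !inord_val => ->.
rewrite -(size_map (fun w => inord w.1 : 'I_100)) -(card_uniqP uo).
apply: eq_card => y; apply/orbitP/mapP => [[g Gg <-] | [w Uw ->]]; last first.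
  by have [g Gg ->] := UP w Uw; exists g; rewrite //= inord_val.
have [w Uw [u def_w Hu]] := decomp g Gg; exists w => //.
rewrite def_w /= inord_val /aperm.
by have := inS' x _ Hu; rewrite permM => /(canRL (permKV _)).
Qed.

Lemma card_gent S bs : validt S -> all (fun x => x < 100) bs ->
  chain_ok S bs -> #|gent S| = (\prod_(p <- chain S bs) size p.2)%N.
Proof.
elim: bs S => [|x bs IH] S vS.
  move=> _ /allP S1; rewrite big_nil; apply/eqP; rewrite -trivg_card1.
  rewrite -subG1 gen_subG; apply/subsetP=> g; rewrite inE => /S1/eqP/esym.
  by rewrite -tab1 => /tab_inj <-; rewrite inE.
case/andP=> ltx ltbs okS; have := okS; case/and4P=> _ _ _ okS'.
have [defC szO] := chain_okP (x := Ordinal ltx) vS ltbs okS.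
rewrite big_cons /= -IH //; last exact: validt_stab.
by rewrite -(card_orbit_stab 'P (gent S) (Ordinal ltx)) defC szO.
Qed.

Definition wordt (gs : seq (seq nat)) (w : seq nat) k :=
  iter k (compt (foldr (fun i => compt (nth idt gs i)) idt w)) idt.

Definition wordg (gs : seq 'S_100) (w : seq nat) k :=
  (\prod_(i <- w) nth 1 gs i) ^+ k.

Arguments wordt : simpl never.
Arguments wordg : simpl never.

Lemma tab_word gs w k : tab (wordg gs w k) = wordt (map tab gs) w k.
Proof.
rewrite /wordt /wordg; elim: k => [|k IHk]; first by rewrite expg0 tab1.
rewrite expgS tabM IHk /=; congr compt.
elim: w {IHk} => [|i w IHw]; first by rewrite big_nil tab1.
rewrite big_cons tabM IHw /=; congr compt.
case: (ltnP i (size gs)) => [lti|gei]; first by rewrite (nth_map 1).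
by rewrite !nth_default ?size_map // tab1.
Qed.

Lemma wordg_in (G : {group 'S_100}) gs w k :
  {subset gs <= G} -> wordg gs w k \in G.
Proof.
move=> sG; apply/groupX/group_prod => i _.
case: (ltnP i (size gs)) => [lti|gei]; first by rewrite sG ?mem_nth.
by rewrite nth_default ?group1.
Qed.

(* Two elements of order 5 that generate J2, and a strong generating set for  *)
(* the base [:: 0; 42; 63; 1] that consists of words in them. *)
Definition j2_cd : seq 'S_100 :=
  let x := [:: 0; 1]%N in let y := [:: 0; 1; 1]%N in
  [:: wordg [:: j2_a; j2_b] (x ++ x ++ y ++ x ++ y ++ y) 2;
      wordg [:: j2_a; j2_b] (x ++ x ++ y ++ y ++ x ++ y) 2].

Definition j2_strong : seq 'S_100 :=
  j2_cd ++
  [:: wordg j2_cd [:: 0; 1; 1; 0; 0; 1; 0; 1]%N 3;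
      wordg j2_cd [:: 1; 0; 1; 1; 0; 1]%N 5;
      wordg j2_cd [:: 1; 1; 1; 0; 0; 1; 0]%N 4].

Definition j2_cdt : seq (seq nat) :=
  let x := [:: 0; 1]%N in let y := [:: 0; 1; 1]%N in
  [:: wordt [:: j2_a_table; j2_b_table] (x ++ x ++ y ++ x ++ y ++ y) 2;
      wordt [:: j2_a_table; j2_b_table] (x ++ x ++ y ++ y ++ x ++ y) 2].

Definition j2_strongt :=
  j2_cdt ++
  [:: wordt j2_cdt [:: 0; 1; 1; 0; 0; 1; 0; 1]%N 3;
      wordt j2_cdt [:: 1; 0; 1; 1; 0; 1]%N 5;
      wordt j2_cdt [:: 1; 1; 1; 0; 0; 1; 0]%N 4].

Definition j2_base := [:: 0; 42; 63; 1]%N.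

Lemma tab_j2_cd : map tab j2_cd = j2_cdt.
Proof. by rewrite /j2_cd /j2_cdt /= !tab_word /= tab_j2_a tab_j2_b. Qed.

Lemma tab_j2_strong : map tab j2_strong = j2_strongt.
Proof.
rewrite /j2_strong /j2_strongt map_cat [map tab (_ :: _ :: _ :: _)]/=.
by rewrite !tab_word tab_j2_cd.
Qed.

Lemma j2_chain_ok : chain_ok j2_strongt j2_base.
Proof. by vm_compute. Qed.

Lemma j2_sift :
  let lv := chain j2_strongt j2_base in
  [&& sift lv j2_a_table, sift lv j2_b_table &
      [seq size p.2 | p <- lv] == [:: 100; 63; 32; 3]].
Proof. by vm_compute. Qed.

Lemma j2_validt : validt j2_strongt.
Proof. by move=> s; rewrite -tab_j2_strong => /mapP[g _ ->]; exists g. Qed.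

Lemma j2_cd_sub : {subset j2_cd <= J2}.
Proof.
have sab: {subset [:: j2_a; j2_b] <= J2}.
  by move=> g; rewrite !inE => /orP[]/eqP->; rewrite mem_gen ?inE ?eqxx ?orbT.
by move=> g; rewrite !inE => /orP[]/eqP->; apply: wordg_in.
Qed.

Lemma gent_j2_strong (G : {group 'S_100}) :
  {subset j2_cd <= G} -> gent j2_strongt \subset G.
Proof.
move=> scdG; rewrite gen_subG; apply/subsetP=> g; rewrite inE -tab_j2_strong.
rewrite (mem_map tab_inj) mem_cat => /orP[/scdG //|].
by rewrite !inE => /or3P[]/eqP->; apply: wordg_in.
Qed.

Lemma gent_j2 : gent j2_strongt = J2.
Proof.
apply/val_inj/eqP; rewrite eqEsubset /= (gent_j2_strong j2_cd_sub) gen_subG.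
have [+ + _] := and3P j2_sift; rewrite -tab_j2_a -tab_j2_b => sa sb.
by apply/subsetP=> g; rewrite !inE => /orP[]/eqP->; apply: (siftP (bs := j2_base) j2_validt).
Qed.

Lemma j2_cd_gen (G : {group 'S_100}) : {subset j2_cd <= G} -> J2 \subset G.
Proof. by rewrite -gent_j2; apply: gent_j2_strong. Qed.

Lemma card_J2 : #|J2| = (2 ^ 7 * 3 ^ 3 * 5 ^ 2 * 7)%N.
Proof.
have [_ _ /eqP szJ] := and3P j2_sift.
have cardJ: #|J2| = (\prod_(i <- [:: 100; 63; 32; 3]) i)%N.
  by rewrite -szJ big_map -gent_j2; apply: card_gent j2_validt _ j2_chain_ok.
rewrite {}cardJ !big_cons big_nil.
have e (a b c d f g : nat) :
  ((a * b) * ((c * d) * (f * (g * 1))) = (a * f) * (c * g) * b * d)%N.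
  by rewrite muln1 !mulnA (ACl (1 * 5 * 3 * 6 * 2 * 4)%AC).
exact: (e (2 ^ 2) (5 ^ 2) (3 ^ 2) 7 (2 ^ 5) 3)%N.
Qed.

Lemma j2_cd5 : {in j2_cd, forall g, g ^+ 5 = 1}.
Proof.
have: all (fun t => wordt [:: t] [:: 0] 5 == idt) (map tab j2_cd).
  by rewrite tab_j2_cd; vm_compute.
move/allP=> cd5 g cd_g; apply: tab_inj; rewrite tab1.
have := cd5 _ (map_f tab cd_g); rewrite -[[:: tab g]]/(map tab [:: g]) -tab_word.
by rewrite /wordg big_seq1 => /eqP.
Qed.

Lemma J2_stab : 'C_J2[ord0 | 'P] = gent (stabt j2_strongt 0).
Proof.
rewrite -gent_j2.
by have [] := chain_okP (x := ord0) (r := behead j2_base) j2_validt isT j2_chain_ok.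
Qed.

Lemma J2_trans : [transitive J2, on setT | 'P].
Proof.
apply/imsetP; exists ord0; rewrite ?inE //; apply/esym/eqP.
rewrite eqEcard subsetT cardsT card_ord -gent_j2.
have [_ ->] := chain_okP (x := ord0) (r := behead j2_base) j2_validt isT j2_chain_ok.
by vm_compute.
Qed.

(* The stabiliser of 0 is transitive on 1 .. 36 and on 37 .. 99. *)
Lemma J2_suborbits (x y : 'I_100) : 0 < x -> 0 < y -> (x < 37) = (y < 37) ->
  y \in orbit 'P 'C_J2[ord0 | 'P] x.
Proof.
set H := 'C_J2[ord0 | 'P].
have vS : validt (stabt j2_strongt 0) := validt_stab j2_validt.
have sub (z t : 'I_100) : val t \in [seq w.1 | w <- transv (stabt j2_strongt 0) z] ->
    t \in orbit 'P H z.
  case/mapP=> w /(transvP vS)[g Hg ->] /= def_t; apply/orbitP; exists g.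
    by rewrite /H J2_stab.
  by apply: val_inj; rewrite /= def_t.
have sub1 (t : 'I_100) : 0 < t < 37 -> t \in orbit 'P H (inord 1).
  move=> t_lt; apply: sub; rewrite inordK //.
  have: let l := [seq w.1 | w <- transv (stabt j2_strongt 0) 1] in
    all (fun i => i \in l) (iota 1 36) by vm_compute.
  by move/allP; apply; rewrite mem_iota.
have sub2 (t : 'I_100) : 37 <= t -> t \in orbit 'P H (inord 37).
  move=> t_ge; apply: sub; rewrite inordK //.
  have: let l := [seq w.1 | w <- transv (stabt j2_strongt 0) 37] in
    all (fun i => i \in l) (iota 37 63) by vm_compute.
  by move/allP; apply; rewrite mem_iota t_ge /= ltn_ord.
move=> x_gt0 y_gt0; case: (ltnP x 37) => [x_lt /esym y_lt | x_ge /esym y_ge].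
  have <- : orbit 'P H (inord 1) = orbit 'P H x.
    by apply/orbit_eqP; rewrite orbit_sym sub1 ?x_gt0.
  by rewrite sub1 ?y_gt0.
have <- : orbit 'P H (inord 37) = orbit 'P H x.
  by apply/orbit_eqP; rewrite orbit_sym sub2.
by rewrite sub2 // leqNgt y_ge.
Qed.

Lemma J2_prim : [primitive J2, on setT | 'P].
Proof.
rewrite (trans_prim_astab (in_setT (ord0 : 'I_100)) J2_trans).
apply/maximal_eqP; split=> [|M sCM sMG]; first exact: subsetIl.
set O := orbit 'P M (ord0 : 'I_100).
have stM : 'C_M[ord0 | 'P] = 'C_J2[ord0 | 'P].
  by apply/eqP; rewrite eqEsubset setSI //= subsetI sCM subsetIr.
have cardM : (#|O| * #|'C_J2[ord0 | 'P]|)%N = #|M| by rewrite -stM card_orbit_stab.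
have cardG : (100 * #|'C_J2[ord0 | 'P]|)%N = #|J2|.
  rewrite -(card_orbit_stab 'P J2 ord0); congr (_ * _)%N.
  by rewrite (atransP J2_trans) ?inE // cardsT card_ord.
have dvO : #|O| %| 100.
  by rewrite -(dvdn_pmul2r (cardG_gt0 'C_J2[ord0 | 'P])) cardM cardG cardSg.
have cl (x y : 'I_100) : x \in O -> 0 < x -> 0 < y -> (x < 37) = (y < 37) -> y \in O.
  move=> Ox x0 y0 exy; have /orbitP[g Cg <-] := J2_suborbits x0 y0 exy.
  exact: orbit_trans (mem_orbit 'P x (subsetP sCM g Cg)) Ox.
pose A := [set x : 'I_100 | 0 < x < 37]; pose B := [set x : 'I_100 | 36 < x].
have cA : #|A| = 36.
  rewrite -sum1_card (eq_bigl (fun x : 'I_100 => 0 < x < 37)) => [|x]; last by rewrite inE.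
  by rewrite -(big_mkord (fun i => 0 < i < 37) (fun=> 1%N)) unlock.
have cB : #|B| = 63.
  rewrite -sum1_card (eq_bigl (fun x : 'I_100 => 36 < x)) => [|x]; last by rewrite inE.
  by rewrite -(big_mkord (fun i => 36 < i) (fun=> 1%N)) unlock.
have O0 : ord0 \in O := orbit_refl 'P M ord0.
have cO : #|O| = (#|O :&: A| + #|O :&: B|.+1)%N.
  rewrite -(cardsID A); congr (_ + _)%N.
  have -> : O :\: A = ord0 |: (O :&: B).
    apply/setP=> x; rewrite !inE; have [-> | nx0] := eqVneq x ord0; first by rewrite O0.
    have -> : 0 < x by rewrite lt0n; apply: contraNneq nx0 => x0; apply/eqP/val_inj.
    by rewrite -leqNgt andbC.
  by rewrite cardsU1 !inE andbF.
have dich (D : {set 'I_100}) : (forall x, x \in D -> 0 < x) ->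
    {in D &, forall x y : 'I_100, (x < 37) = (y < 37)} -> O :&: D = D \/ O :&: D = set0.
  move=> D0 D37; have [-> | [x /setIP[Ox Dx]]] := set_0Vmem (O :&: D); first by right.
  left; apply/setIidPr/subsetP=> y Dy.
  exact: cl Ox (D0 x Dx) (D0 y Dy) (D37 x y Dx Dy).
have dA : O :&: A = A \/ O :&: A = set0.
  apply: dich => [x|x y]; rewrite !inE; first by case/andP.
  by case/andP=> _ -> /andP[_ ->].
have dB : O :&: B = B \/ O :&: B = set0.
  apply: dich => [x|x y]; rewrite !inE; first exact: leq_trans.
  by move=> lx ly; rewrite (ltnNge x) (ltnNge y) lx ly.
move: dvO; case: dA dB cO cardM => -> [] ->; rewrite ?cA ?cB ?cards0 => -> //= cM _.
  right; apply/eqP; rewrite eqEcard sMG /=.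
  by rewrite -cM -cardG leqnn.
left; apply/esym/eqP; rewrite eqEcard sCM /=.
by rewrite -cM mul1n leqnn.
Qed.

Lemma simple_J2 : simple J2.
Proof.
have nt: J2 :!=: 1.
  apply/eqP=> J1; have := card_J2; rewrite J1 cards1 => /(congr1 (dvdn 7)).
  by rewrite dvdn_mull.
apply/simpleP; split=> // K nKG.
have [/subsetP KC | trK] := prim_trans_norm J2_prim nKG; [left | right].
  apply/trivgP/subsetP=> g /KC/setIP[_ /astabP gfix].
  by rewrite inE; apply/eqP/permP=> x; rewrite perm1; apply: gfix; rewrite inE.
have dvK : 100 %| #|K|.
  by have := atrans_dvd trK; rewrite cardsT card_ord.
apply/eqP; rewrite eqEsubset (normal_sub nKG); apply: j2_cd_gen => g cd_g.
have Gg := j2_cd_sub cd_g; have nKg := subsetP (normal_norm nKG) g Gg.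
have co5 : coprime 5 #|J2 / K|.
  rewrite card_quotient ?normal_norm // prime_coprime //; apply/negP=> dv5.
  have: 5 ^ 3 %| #|J2|.
    rewrite -(Lagrange (normal_sub nKG)) (expnSr 5 2) dvdn_mul //.
    by apply: dvdn_trans dvK.
  by rewrite card_J2 mulnAC (mulnC _ (5 ^ 2)%N) (expnSr 5 2) dvdn_pmul2l.
rewrite coset_idr //; apply/eqP; rewrite -order_eq1 -dvdn1.
apply: (dvdn_trans (n := gcdn 5 #|J2 / K|)); last by rewrite (eqP co5).
rewrite dvdn_gcd order_dvdn -morphX // j2_cd5 // morph1 eqxx.
by rewrite order_dvdG // mem_quotient.
Qed.

(* Main.v *)
Require Import Defs.
From HB Require Import structures.
From mathcomp Require Import all_boot ssrAC all_fingroup all_solvable.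

Set Implicit Arguments.
Unset Strict Implicit.
Unset Printing Implicit Defensive.

Local Open Scope group_scope.

(* Let z be a 2A involution of J2 and M = C(z), so M = 2^{1+4}:A5 has index   *)
(* 315. The suborbits of J2 on the class of z have lengths 1, 10, 32, 32, 80  *)
(* and 160; no partial sum of these other than 1 and 315 divides 315, so M is *)
(* maximal. Let t lie in a suborbit of length 32. The subgroup generated by   *)
(* T = t^M is normalised by M and by t, hence by J2, and is J2 by simplicity. *)
(* An element of M that centralises T is therefore central in J2, so M acts   *)
(* faithfully on the 32 points of T, and this action is the control group.    *)

(** * Homomorphisms from progenitors *)

(** Let G be a nonabelian simple group, M a maximal subgroup and t an involution of G outside M, and
    let T be the class of t under M. The normaliser of [<<T>>] contains M and t, so T generates G,
    and M acts faithfully on T by conjugation. The universal property of the progenitor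
    ([progenitor_morphism]) turns this action into the required surjection; this is
    [symmetric_generation]. It remains to find such M and t in [J2] with 32 conjugates. An
    extraspecial E of order 32 and a complement A of order 60 are built inside C(z), so the class of
    z has size dividing 315. The suborbit lengths then leave only size 315 ([card_j2_z_class]),
    whence C(z) = EA ([M_J2_eq]), and the same arithmetic makes C(z) maximal ([maximal_cent1]). The
    finite data are orbits of permutation tables. Their enumeration is sound by construction, and a
    closure test makes it complete. *)

Section ProgenitorMorphism.
Variables (gT : finGroupType) (G : {group gT}) (n : nat) (t : 'I_n -> gT).
Hypotheses (Gt : forall i, t i \in G) (tt : forall i, t i * t i = 1).

(** Cancelling two adjacent equal letters keeps the product, because each [t i] squares to 1. *)
Lemma prod_word_mul (u v : seq 'I_n) :
  \prod_(i <- word_mul u v) t i = (\prod_(i <- u) t i) * (\prod_(i <- v) t i).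
Proof.
elim: u => [|i u IHu]; first by rewrite big_nil mul1g.
rewrite big_cons -mulgA -IHu /=.
case: (word_mul u v) => [|j w] /=; first by rewrite big_seq1 big_nil mulg1.
by case: eqP => [->|_]; rewrite !big_cons // mulgA tt mul1g.
Qed.

(** The pair (s, x) goes to [tau s] times the product of the letters of x; equivariance of [t] lets
    [tau s] move past a word. *)
Lemma progenitor_morphism (N : {group 'S_n}) (tau : {morphism N >-> gT}) :
    tau @* N \subset G ->
    (forall s i, s \in N -> t i ^ tau s = t (s i)) ->
  exists phi : {multiplicative progenitor N -> [subg G]},
    (forall s : [subg N], sgval (phi (prog_N s)) = tau (sgval s)) /\
    (forall i, sgval (phi (prog_t N i)) = t i).
Proof.
move=> sNG tJ.
pose f (p : progenitor N) : gT :=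
  tau (sgval (prog_ctl p)) * \prod_(i <- fword (prog_free p)) t i.
have Gf p : f p \in G.
  rewrite groupM ?group_prod //.
  by rewrite (subsetP sNG) // mem_morphim ?subgP.
have fM p q : f (p * q) = f p * f q.
  rewrite /f /= prod_word_mul morphM ?subgP // -!mulgA; congr (_ * _).
  rewrite !mulgA; congr (_ * _).
  rewrite [RHS]conjgC; congr (_ * _).
  rewrite big_map (big_morph (conjg^~ _) (fun x y => conjMg x y _) (conj1g _)).
  by apply: eq_bigr => i _; rewrite tJ ?subgP.
have phiM : {morph (fun p => subg G (f p)) : p q / p * q}.
  by move=> p q; apply: val_inj; rewrite /= !subgK // fM.
pose mul := isMultiplicative.Build _ _ (fun p => subg G (f p)) phiM.
pose phi : {multiplicative progenitor N -> [subg G]} :=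
  HB.pack (fun p => subg G (f p)) mul.
exists phi; split=> [s|i]; rewrite /= subgK //; rewrite /f /=.
  by rewrite big_nil mulg1.
by rewrite morph1 mul1g big_seq1.
Qed.

End ProgenitorMorphism.

(** * Symmetric generation from a maximal subgroup *)

Lemma perm_morphism (gT : finGroupType) (D : {group gT}) (T : finType)
    (to : T -> gT -> T) :
    (forall x, to x 1 = x) ->
    {in D &, forall a b x, to x (a * b) = to (to x a) b} ->
  exists f : {morphism D >-> {perm T}}, forall a x, a \in D -> f a x = to x a.
Proof.
(* An action must be injective in the point for every group element, so it is extended by the
   identity outside [D]. *)
move=> to1 toM; pose to' x a := if a \in D then to x a else x.
have actP : is_action D to'.
  split=> [a x y | x a b Da Db]; rewrite /to'; last by rewrite groupM ?Da ?Db ?toM.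
  case: ifP => // Da /(congr1 (to^~ a^-1)).
  by rewrite -!toM ?groupV // mulgV !to1.
exists (actperm (Action actP)) => a x Da.
by rewrite actpermE /= /to' Da.
Qed.

Lemma symmetric_generation (gT : finGroupType) (G M : {group gT}) (t : gT) n :
    simple G -> ~~ abelian G -> maximal M G -> t \in G -> t \notin M ->
    #[t] = 2 -> #|t ^: M| = n ->
  exists N : {group 'S_n},
    [/\ [transitive N, on [set: 'I_n] | 'P],
        N \isog M
      & exists phi : {multiplicative progenitor N -> [subg G]},
          [/\ forall y : [subg G], exists x : progenitor N, phi x = y,
              injective (fun s : [subg N] => phi (prog_N s)),
              injective (fun i : 'I_n => phi (prog_t N i)),
              forall i : 'I_n, #[phi (prog_t N i)] = 2
            & <<[set phi (prog_t N i) | i : 'I_n]>> = [set: [subg G]]]].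
Proof.
move=> simG nabG maxM Gt nMt ot <-{n}; set T := t ^: M.
have sMG : M \subset G  by apply/proper_sub/(maxgroupp maxM).
have sTG : T \subset G by apply: class_subG.
have Tt : t \in T := class_refl M t.
have nTM : M \subset 'N(T) by apply: class_norm.
have genT : <<T>> = G.
  have nTG : <<T>> <| G.
    rewrite /normal gen_subG sTG /=.
    (* By maximality this normaliser is [M] or [G]; it contains [t], which rules out [M]. *)
    have sMN : M \subset 'N_G(<<T>>) by rewrite subsetI sMG norms_gen.
    have /maximal_eqP[_ maxM'] : maximal_eq M G by rewrite /maximal_eq maxM orbT.
    have := maxM' _ sMN (subsetIl _ _).
    case=> defN; last first.
      by rewrite -{1}defN subsetIr.
    case/negP: nMt; rewrite -defN inE Gt (subsetP (normG _)) //.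
    exact: mem_gen.
  case/simpleP: simG => _ /(_ _ nTG)[/= T1|//].
  have: t \in <<T>> by apply: mem_gen.
  by rewrite T1 => /set1P t1; rewrite t1 order1 in ot.
have ZG : 'Z(G) = 1.
  case/simpleP: simG => _ /(_ _ (center_normal G))[//|/= ZG].
  by case/negP: nabG; rewrite -ZG center_abelian.
have TJ (i : 'I_#|T|) m : m \in M -> enum_val i ^ m \in T.
  by move=> Mm; rewrite memJ_norm ?enum_valP // (subsetP nTM).
pose to (i : 'I_#|T|) m := enum_rank_in Tt (enum_val i ^ m).
have toE i m : m \in M -> enum_val (to i m) = enum_val i ^ m.
  by move=> Mm; rewrite enum_rankK_in ?TJ.
have [] := @perm_morphism _ M _ to.
- by move=> i; rewrite /to conjg1 enum_valK_in.
- by move=> a b Ma Mb i; apply: enum_val_inj; rewrite !toE ?groupM ?conjgM.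
move=> f fE.
have {toE} fE i m : m \in M -> enum_val (f m i) = enum_val i ^ m.
  by move=> Mm; rewrite fE ?toE.
(* An element of [M] that fixes [T] pointwise centralises [<<T>>] = [G], so it lies in the trivial
   centre. *)
have injf : 'injm f.
  apply/subsetP=> m; rewrite !inE => /andP[Mm /eqP fm1].
  rewrite -in_set1 -[[set 1]]/(1%g : {set gT}) -ZG inE (subsetP sMG) //=.
  rewrite -genT cent_gen; apply/centP=> x Tx; apply/esym/commgP/conjg_fixP.
  by have := fE (enum_rank_in Tt x) _ Mm; rewrite fm1 perm1 enum_rankK_in.
have isoN : f @* M \isog M by rewrite isog_sym sub_isog.
pose tau := invm_morphism injf.
have tauK m : m \in M -> tau (f m) = m by apply: invmE.
have tauM s : s \in f @* M -> tau s \in M.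
  by case/morphimP=> m _ Mm ->; rewrite tauK.
have tt (i : 'I_#|T|) : enum_val i * enum_val i = 1.
  have /imsetP[m _ ->] := enum_valP i.
  by rewrite -conjMg (_ : t * t = 1) ?conj1g // -[RHS](expg_order t) ot.
have [||| phi [phiN phiT]] :=
    @progenitor_morphism _ G _ (fun i : 'I_#|T| => enum_val i) _ tt [group of f @* M] tau.
- by move=> i; rewrite (subsetP sTG) ?enum_valP.
- by apply/subsetP=> _ /morphimP[s _ /tauM Ms ->]; apply: (subsetP sMG).
- by move=> s i /morphimP[m _ Mm ->]; rewrite tauK ?fE.
have genphi : <<[set phi (prog_t (f @* M) i) | i : 'I_#|T|]>> = [set: [subg G]].
  rewrite -[LHS]sgvalmK morphim_gen ?subsetT // morphimEsub ?subsetT //.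
  rewrite -imset_comp (_ : imset _ _ = T) ?genT ?im_subg //.
  apply/setP=> x; apply/imsetP/idP=> [[i _ ->] | Tx]; rewrite /= ?phiT ?enum_valP //.
  by exists (enum_rank_in Tt x); rewrite //= phiT enum_rankK_in.
exists [group of f @* M]; split=> //.
  apply/imsetP; exists (enum_rank_in Tt t); rewrite ?inE //.
  apply/esym/eqP; rewrite -subTset; apply/subsetP=> i _.
  have /imsetP[m Mm defi] := enum_valP i.
  apply/orbitP; exists (f m); first exact: mem_morphim.
  by apply: enum_val_inj; rewrite /= /aperm fE // enum_rankK_in.
exists phi; split=> //.
- move=> y.
  (* In a finite group [y] is a product of generators without inverses, so a preimage is built
     letter by letter. *)
  have: y \in <<[set phi (prog_t (f @* M) i) | i : 'I_#|T|]>> by rewrite genphi inE.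
  case/gen_prodgP=> k [c Tc ->] {y}.
  elim: k c Tc => [|k IHk] c Tc; last first.
    have [x defx] := IHk _ (fun i => Tc (lift ord0 i)).
    have /imsetP[i _ ci] := Tc ord0.
    by exists (prog_t _ i * x); rewrite big_ord_recl gmulfM ci defx.
  by exists (prog_N 1); rewrite big_ord0; apply: val_inj; rewrite /= phiN morph1.
- move=> r s /(congr1 sgval); rewrite !phiN => e; apply: val_inj => /=.
  by have /injmP tau_inj := injm_invm injf; apply: tau_inj e; apply: subgP.
- by move=> i j /(congr1 sgval); rewrite !phiT; apply: enum_val_inj.
move=> i; rewrite -(order_injm (injm_sgval G)) ?inE //= phiT.
by have /imsetP[m _ ->] := enum_valP i; rewrite orderJ.
Qed.

(** * Group-theoretic criteria *)

(** The image has index 2 in S_5, so it meets the simple group Alt_5 in a normal subgroup of Alt_5.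
    A trivial intersection would give 3600 products in a group of order 120. *)
Lemma isog_Alt5 (gT : finGroupType) (A : {group gT}) (f : {morphism A >-> 'S_5}) :
  'injm f -> #|A| = 60 -> A \isog 'Alt_('I_5).
Proof.
move=> injf cA; have cK : #|f @* A| = 60 by rewrite card_injm.
have cAlt : #|'Alt_('I_5)| = 60.
  by apply/eqP; rewrite -(eqn_pmul2l (ltn0Sn 1)) card_Alt card_ord.
have cSym : #|[set: 'S_5]| = (2 * 60)%N by rewrite card_Sym card_ord.
have nK : f @* A <| [set: 'S_5].
  by rewrite index2_normal ?subsetT // -divgS ?subsetT // cSym cK.
suff <- : f @* A = 'Alt_('I_5) by rewrite sub_isog.
have /simpleP[_ /(_ _ (normalGI (subsetT 'Alt_('I_5)) nK))[/= TI|/= defI]] :=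
  @simple_Alt5 ('I_5) (eq_leq (esym (card_ord 5))); last first.
  by apply/eqP; rewrite eq_sym eqEcard -{1}defI subsetIr cK cAlt.
have := subset_leq_card (subsetT ('Alt_('I_5) * f @* A)).
by rewrite TI_cardMg // cAlt cK cSym.
Qed.

(** E/Z(E) is elementary abelian, so the Frattini subgroup lies in Z(E); the nontrivial derived
    subgroup fills Z(E), which has prime order, and lies in the Frattini subgroup. *)
Lemma extraspecial_center (gT : finGroupType) p (E : {group gT}) :
    prime p -> p.-group E -> ~~ abelian E -> #|'Z(E)| = p ->
    {in E &, forall x y, [~ x, y] \in 'Z(E)} ->
    {in E, forall x, x ^+ p \in 'Z(E)} ->
  extraspecial E.
Proof.
move=> pr_p pE nabE oZ derZ expZ.
have sE'Z : E^`(1) \subset 'Z(E).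
  by rewrite gen_subG; apply/subsetP=> _ /imset2P[x y Ex Ey ->]; apply: derZ.
have nZE : E \subset 'N('Z(E)) by rewrite normal_norm ?center_normal.
have sPhiZ : 'Phi(E) \subset 'Z(E).
  apply: (Phi_min pE nZE); apply/(abelemP pr_p); split; first exact: sub_der1_abelian.
  move=> _ /morphimP[x Nx Ex ->].
  by rewrite -morphX //= coset_id ?expZ.
have defE' : E^`(1) = 'Z(E).
  apply/eqP; rewrite eqEcard sE'Z /= oZ.
  have: #|E^`(1)| %| p by rewrite -oZ cardSg.
  case/primeP: pr_p => _ /[apply] /orP[|/eqP->//].
  by rewrite -trivg_card1 => /eqP/derG1P E'1; rewrite E'1 in nabE.
split; last by rewrite oZ.
split=> //; apply/eqP; rewrite eqEsubset sPhiZ -defE'.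
by rewrite (Phi_joing pE) joing_subl.
Qed.

Fixpoint subsums (s : seq nat) : seq nat :=
  if s is n :: s' then subsums s' ++ [seq (n + m)%N | m <- subsums s'] else [:: 0]%N.

(** Each block lies inside [S] or misses it, so [S] is a disjoint union of some of the blocks. *)
Lemma subsumsP (T : eqType) (Bs : seq (seq T)) (S : seq T) :
    uniq S -> uniq (flatten Bs) -> {subset S <= flatten Bs} ->
    {in Bs, forall B x y, x \in B -> y \in B -> x \in S -> y \in S} ->
  size S \in subsums [seq size B | B <- Bs].
Proof.
move=> uS uB sSB clB.
have -> : size S = size [seq x <- flatten Bs | x \in S].
  apply/perm_size/uniq_perm; rewrite ?filter_uniq // => x.
  by rewrite mem_filter andb_idr //; apply: sSB.
elim: Bs clB {uB sSB} => //= B Bs IH clB.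
have {}IH := IH (fun P BsP => clB P (mem_behead (s := B :: Bs) BsP)).
rewrite filter_cat size_cat mem_cat.
have [/hasP[x Bx Sx] | nS] := boolP (has (mem S) B).
  rewrite (all_filterP _) ?map_f ?orbT //.
  by apply/allP=> y By; apply: (clB B (mem_head B Bs) x).
have/eqP-> : size [seq x <- B | x \in S] == 0.
  by rewrite size_filter -leqn0 leqNgt -has_count.
by rewrite add0n IH.
Qed.

(** For H between C_G(z) and G, the class of z under H has size |H : C_G(z)|, which divides |G :
    C_G(z)|; so the admissible sizes exclude every intermediate H. *)
Lemma maximal_cent1 (gT : finGroupType) (G : {group gT}) z (ds : seq nat) :
    (forall H : {group gT}, 'C_G[z] \subset H -> H \subset G -> #|z ^: H| \in ds) ->
    {in ds, forall d, d %| #|z ^: G| -> d = 1%N \/ d = #|z ^: G|} ->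
    #|z ^: G| != 1%N ->
  maximal 'C_G[z] G.
Proof.
move=> cards_ds dvd_ds nz1.
have: maximal_eq 'C_G[z] G.
  apply/maximal_eqP; split=> [|H sCH sHG]; first exact: subsetIl.
  have defC : 'C_H[z] = 'C_G[z].
    by apply/eqP; rewrite eqEsubset setSI //= subsetI sCH subsetIr.
  have iH : (#|'C_G[z]| * #|z ^: H|)%N = #|H|.
    by rewrite -defC -index_cent1 Lagrange ?subsetIl.
  have iG : (#|'C_G[z]| * #|z ^: G|)%N = #|G|.
    by rewrite -index_cent1 Lagrange ?subsetIl.
  have: #|z ^: H| %| #|z ^: G|.
    by rewrite -(dvdn_pmul2l (cardG_gt0 'C_G[z])) iH iG cardSg.
  case/(dvd_ds _ (cards_ds H sCH sHG)) => oz; [left | right].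
    by apply/esym; apply/eqP; rewrite eqEcard sCH -iH oz muln1 /=.
  by apply/eqP; rewrite eqEcard sHG -iH oz iG /=.
case/orP=> // /eqP defG; case/negP: nz1.
by rewrite -index_cent1 defG indexgg.
Qed.

(** * Orbits and groups of permutation tables *)

(* The acting table comes first, so that its inverse is computed only once    *)
(* when a partial application is evaluated.                                   *)
Definition conjt (s : seq nat) : seq nat -> seq nat :=
  let s' := invt s in fun w => compt s' (compt w s).

Lemma tabJ x g : tab (x ^ g) = conjt (tab g) (tab x).
Proof. by rewrite /conjg !tabM tabV. Qed.

Section OrbitTables.
Variables (to : {action 'S_100 &-> 'S_100}) (tot : seq nat -> seq nat -> seq nat).
Hypothesis totE : forall x g, tab (to x g) = tot (tab g) (tab x).

(** Breadth-first search: [U] holds the tables found, [Q] those still to be expanded. *)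
Fixpoint growt k (fs : seq (seq nat -> seq nat)) (U Q : seq (seq nat)) :=
  if k is k'.+1 then
    if Q is w :: Q' then
      let new := [seq s <- undup [seq f w | f <- fs] | s \notin U] in
      growt k' fs (U ++ new) (Q' ++ new)
    else U
  else U.

(* The fuel 400 exceeds the length of every orbit that is enumerated. *)
Definition orbt (S : seq (seq nat)) (t : seq nat) := growt 400 (map tot S) [:: t] [:: t].

Definition closedt (S L : seq (seq nat)) :=
  let fs := map tot S in all (fun w => all (fun f => f w \in L) fs) L.

Variables (S : seq (seq nat)) (x : 'S_100).
Hypothesis vS : validt S.
Let B := orbit to (gent S) x.

(** Soundness of the search; the induction works for any amount of fuel. *)
Lemma orbtP : {in orbt S (tab x), forall w, exists2 y, y \in B & w = tab y}.
Proof.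
pose P w := exists2 y, y \in B & w = tab y.
have PM w s : P w -> s \in S -> P (tot s w).
  move=> [y By ->] Ss; have [g defs] := vS Ss; exists (to y g); last by rewrite -defs totE.
  by apply: orbit_trans By; apply: mem_orbit; rewrite mem_gen // inE defs.
have Px : {in [:: tab x], forall w, P w}.
  by move=> w /[1!inE] /eqP->; exists x; rewrite ?orbit_refl.
suff growP k U Q : {in U, forall w, P w} -> {in Q, forall w, P w} ->
    {in growt k (map tot S) U Q, forall w, P w} by apply: growP.
elim: k U Q => // k IH U [|w Q] // PU PQ.
rewrite /=; set new := filter _ _.
have Pnew : {in new, forall v, P v}.
  move=> v; rewrite mem_filter mem_undup -map_comp => /andP[_ /mapP[s Ss ->]].
  by apply: PM => //; apply: PQ; apply: mem_head.
apply: IH => v; rewrite mem_cat => /orP[Uv|/Pnew//]; first exact: PU.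
by apply: PQ; rewrite inE Uv orbT.
Qed.

(** Completeness: elements of a finite group are products of generators, so stability under the
    generators alone suffices. *)
Lemma orbt_closed (L : seq (seq nat)) :
  tab x \in L -> closedt S L -> {in B, forall y, tab y \in L}.
Proof.
move=> Lx /allP clL _ /orbitP[g Gg <-].
case/gen_prodgP: Gg => k [c Sc ->].
elim: k c Sc => [|k IHk] c Sc; first by rewrite big_ord0 act1.
rewrite big_ord_recr actM totE.
have := clL _ (IHk _ (fun i => Sc (widen_ord (leqnSn k) i))).
rewrite all_map => /allP; apply.
by have := Sc ord_max; rewrite inE.
Qed.

Lemma orbt_orbit : closedt S (orbt S (tab x)) -> tab x \in orbt S (tab x) ->
  B = [set y | tab y \in orbt S (tab x)].
Proof.
move=> clL Lx; apply/setP=> y; rewrite inE; apply/idP/idP=> [|/orbtP[y' By']].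
  exact: orbt_closed.
by move/tab_inj->.
Qed.

Lemma card_orbt : closedt S (orbt S (tab x)) -> tab x \in orbt S (tab x) ->
  uniq (orbt S (tab x)) -> #|B| = size (orbt S (tab x)).
Proof.
move=> clL Lx uL; rewrite cardE -(size_map tab).
apply/perm_size/uniq_perm; rewrite ?(map_inj_uniq tab_inj) ?enum_uniq // => w.
apply/mapP/idP=> [[y /[!mem_enum] By ->] | /orbtP[y By ->]].
  exact: orbt_closed By.
by exists y; rewrite ?mem_enum.
Qed.

End OrbitTables.

Lemma gentS (S T : seq (seq nat)) : {subset S <= T} -> gent S \subset gent T.
Proof. by move=> sST; apply/genS/subsetP=> g; rewrite !inE; apply: sST. Qed.

(** * Groups given by the list of their tables *)

Definition mult (s w : seq nat) := compt w s.

Lemma tabR x g : tab ('R%act x g) = mult (tab g) (tab x).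
Proof. exact: tabM. Qed.

(** This makes listing the elements of a group a case of orbit enumeration. *)
Lemma orbitR (gT : finGroupType) (H : {group gT}) : orbit 'R H 1 = H.
Proof.
apply/setP=> x; apply/orbitP/idP=> [[h Hh <-] | Hx]; first by rewrite /= mul1g.
by exists x; rewrite //= mul1g.
Qed.

Definition enumt (G : {group 'S_100}) (L : seq (seq nat)) :=
  (forall g, (g \in G) = (tab g \in L)) /\ validt L.

Lemma gent_enumt S : validt S ->
    closedt mult S (orbt mult S idt) -> idt \in orbt mult S idt ->
  enumt (gent S) (orbt mult S idt).
Proof.
move=> vS; rewrite -tab1 => clL L1; split=> [g|w].
  by rewrite -(orbitR (gent S)) (orbt_orbit tabR vS clL L1) inE.
by case/(orbtP tabR vS)=> g _ ->; exists g.
Qed.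

Section EnumeratedGroup.
Variables (G : {group 'S_100}) (L : seq (seq nat)).
Hypothesis GL : enumt G L.

Lemma card_enumt : uniq L -> #|G| = size L.
Proof.
case: GL => memL vL uL; rewrite cardE -(size_map tab).
apply/perm_size/uniq_perm; rewrite ?(map_inj_uniq tab_inj) ?enum_uniq // => w.
apply/mapP/idP=> [[g /[!mem_enum] Gg ->] | Lw]; first by rewrite -memL.
by have [g defw] := vL _ Lw; exists g; rewrite // mem_enum memL defw.
Qed.

Lemma TI_enumt (H : {group 'S_100}) K : enumt H K ->
  all (fun w => (w \in K) ==> (w == idt)) L -> H :&: G = 1.
Proof.
case: GL => memL _ [memK _] /allP TI; apply/trivgP/subsetP=> g /setIP[].
rewrite memL memK => Kg /TI/implyP/(_ Kg).
by rewrite -tab1 (inj_eq tab_inj) inE.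
Qed.

Lemma extraspecial_enumt z : z \in G -> z != 1 -> 2.-group G -> 2 < #|G| ->
    all (fun s => compt (tab z) s == compt s (tab z)) L ->
    all (fun s => [&& compt s s \in [:: idt; tab z],
      all (fun r => compt s r \in [:: compt r s; compt (compt r s) (tab z)]) L &
      (s \in [:: idt; tab z]) || has (fun r => compt s r != compt r s) L]) L ->
  extraspecial G.
Proof.
case: GL => memL vL Gz nz1 pG G_gt2 /allP zC /allP okL.
(* The tests exhibit, for each element other than 1 and [z], an element that does not commute with
   it. *)
have defZ : 'Z(G) = [set 1; z].
  apply/setP=> g; apply/centerP/idP=> [[Gg gC] | ].
    have := Gg; rewrite memL => /okL/and3P[_ _]; rewrite -tab1 !inE !(inj_eq tab_inj).
    case/orP=> // /hasP[s Ls]; have [h defs] := vL _ Ls.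
    by rewrite -defs -!tabM gC ?eqxx // memL defs.
  rewrite !inE => /orP[]/eqP->; first by split=> // h _; apply: commute_sym (commute1 h).
  split=> // h; rewrite memL => /zC/eqP; rewrite -!tabM; exact: tab_inj.
have oZ : #|'Z(G)| = 2 by rewrite defZ cards2 eq_sym nz1.
apply: (@extraspecial_center _ 2) => //.
- by apply/negP=> /center_idP defG; rewrite -defG oZ in G_gt2.
- move=> g h; rewrite !memL => /okL/and3P[_ /allP gC _] /gC.
  rewrite defZ -!tabM !inE !(inj_eq tab_inj) => /orP[]/eqP gh.
    by rewrite commgEl /conjg gh mulKg mulVg eqxx.
  by rewrite commgEl /conjg mulgA -invMg gh mulKg eqxx orbT.
by move=> g; rewrite memL => /okL/and3P[+ _ _]; rewrite -tabM -tab1 defZ !inE !(inj_eq tab_inj).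
Qed.

(* [label] maps the points of five blocks permuted by G to the number of      *)
(* their block, and [rep] picks a point in each block.                        *)
Lemma isog_Alt5_enumt (label rep : nat -> nat) :
    (forall i : 'I_5, rep i < 100 /\ label (rep i) = i) -> #|G| = 60 ->
    all (fun w => all (fun i => (label i < 5) ==>
      (label (nth 0 w i) == label (nth 0 w (rep (label i)))) &&
      (label (nth 0 w i) < 5)) (iota 0 100)) L ->
    all (fun w => all (fun i => label (nth 0 w (rep i)) == i) (iota 0 5) ==>
      (w == idt)) L ->
  G \isog 'Alt_('I_5).
Proof.
case: GL => memL _ repP oG /allP okL /allP faithL.
(* A block is moved through its representative; by the first test on [L], any other point of the
   block gives the same result. *)
pose to (i : 'I_5) (g : 'S_100) : 'I_5 := inord (label (nth 0 (tab g) (rep i))).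
have labP g x : g \in G -> x < 100 -> label x < 5 ->
    label (nth 0 (tab g) x) = label (nth 0 (tab g) (rep (label x))) /\
    label (nth 0 (tab g) x) < 5.
  rewrite memL => /okL/allP okg ltx lx5.
  by have := okg x; rewrite mem_iota lx5 => /(_ ltx)/andP[/eqP].
have ltg g (i : 'I_5) : g \in G -> label (nth 0 (tab g) (rep i)) < 5.
  by move=> Gg; have [lti repK] := repP i; have [|//] := labP g _ Gg lti; rewrite repK.
have toE (i : 'I_5) g : g \in G -> to i g = label (nth 0 (tab g) (rep i)) :> nat.
  by move=> Gg; rewrite inordK // ltg.
have [] := @perm_morphism _ G _ to.
- move=> i; have [lti repK] := repP i.
  by apply: val_inj; rewrite /= toE // tab1 nth_iota.
- move=> g h Gg Gh i; have [lti repK] := repP i.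
  apply: val_inj; rewrite /= !toE ?groupM // tabM (nth_map 0) ?size_tab //.
  have ltg100 : nth 0 (tab g) (rep i) < 100.
    by have := nth_tab g (Ordinal lti); rewrite /= => ->.
  by have [->] := labP h _ Gh ltg100 (ltg g i Gg).
move=> f fE; apply: (@isog_Alt5 _ _ f) => //.
apply/subsetP=> g; rewrite !inE => /andP[Gg /eqP fg1].
have := Gg; rewrite memL => /faithL/implyP okg.
rewrite -(inj_eq tab_inj) tab1; apply: okg; apply/allP=> i; rewrite mem_iota => /= lti.
by rewrite -(toE (Ordinal lti)) // -fE // fg1 perm1.
Qed.

End EnumeratedGroup.

(* The class of z under H is a union of classes under the subgroup gent S.    *)
Lemma card_class_subsums (H : {group 'S_100}) (S T : seq (seq nat)) z
    (rs : seq 'S_100) (Bs : seq (seq (seq nat))) :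
    validt S -> validt T -> gent S \subset H -> H \subset gent T ->
    Bs = [seq orbt conjt S (tab r) | r <- rs] -> uniq (flatten Bs) ->
    tab z \in flatten Bs -> closedt conjt T (flatten Bs) ->
  #|z ^: H| \in subsums [seq size B | B <- Bs].
Proof.
move=> vS vT sSH sHT defBs uBs zBs clBs.
rewrite cardE -(size_map tab); apply: subsumsP => //.
- by rewrite (map_inj_uniq tab_inj) enum_uniq.
- move=> _ /mapP[y /[!mem_enum] zy ->].
  (* [flatten Bs] contains [z] and is stable under [gent T], so it contains the class of [z] under
     [H]. *)
  apply: (orbt_closed (to := 'J%act) tabJ (S := T)) zBs clBs _ _.
  exact: subsetP (classS _ sHT) _ zy.
move=> B; rewrite defBs => /mapP[r _ ->] s1 s2.
case/(orbtP (to := 'J%act) tabJ vS)=> _ /imsetP[m1 /(subsetP sSH) Hm1 ->] ->.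
case/(orbtP (to := 'J%act) tabJ vS)=> _ /imsetP[m2 /(subsetP sSH) Hm2 ->] ->.
by rewrite !(mem_map tab_inj) !mem_enum !memJ_norm ?(subsetP (class_norm z H)).
Qed.

(** * The maximal subgroup of J2 *)

(* [j2_word p k] is the k-th power of the word read off from p, where 0       *)
(* stands for ab and 1 for abb.                                               *)
Definition j2_letters (p : seq nat) : seq nat :=
  flatten [seq nth [::] [:: [:: 0; 1]; [:: 0; 1; 1]] c | c <- p]%N.
Definition j2_word p k := wordg [:: j2_a; j2_b] (j2_letters p) k.
Definition j2_wordt p k := wordt [:: j2_a_table; j2_b_table] (j2_letters p) k.

Lemma tab_j2_word p k : tab (j2_word p k) = j2_wordt p k.
Proof. by rewrite tab_word /= tab_j2_a tab_j2_b. Qed.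

Lemma j2_word_in p k : j2_word p k \in J2.
Proof.
apply: wordg_in => g; rewrite !inE => /orP[]/eqP->;
by rewrite mem_gen ?inE ?eqxx ?orbT.
Qed.

(* z is a 2A involution, e an element of order 4 of O_2(C(z)) with e^2 = z,   *)
(* and u, v generate a complement to O_2(C(z)) in C(z). The product t z has   *)
(* order 5.                                                                   *)
Definition j2_z := j2_word [:: 0; 1]%N 6.
Definition j2_e := j2_word [:: 0; 1]%N 3.
Definition j2_t := j2_word [:: 0; 0; 1; 1]%N 6.

Definition j2_zt := j2_wordt [:: 0; 1]%N 6.
Definition j2_et := j2_wordt [:: 0; 1]%N 3.
Definition j2_ut := j2_wordt [:: 1; 0; 0; 0; 0; 0]%N 1.
Definition j2_vt := j2_wordt [:: 1; 0; 1]%N 4.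
Definition j2_tt := j2_wordt [:: 0; 0; 1; 1]%N 6.

Definition uvt := [:: j2_ut; j2_vt].
Definition euvt := [:: j2_et; j2_ut; j2_vt].
Definition At := orbt mult uvt idt.
Definition eAt := orbt conjt uvt j2_et.
Definition Et := orbt mult eAt idt.

Definition tMt := orbt conjt euvt j2_tt.

(* The sixth powers of these words represent the suborbits. *)
Definition zJ2_words : seq (seq nat) :=
  [:: [:: 0; 1]; [:: 0; 0; 1; 0; 1; 0]; [:: 0; 0; 1; 1];
      [:: 0; 1; 1; 0]; [:: 0; 0; 1; 1; 0]; [:: 1; 0]]%N.
Definition zJ2t := [seq orbt conjt euvt (j2_wordt p 6) | p <- zJ2_words].

(* Blocks of imprimitivity for <u, v> on the orbit of 0. *)
Definition label (i : nat) : nat := find (fun B : seq nat => i \in B)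
  [:: [:: 0; 17; 19; 28]; [:: 5; 33; 67; 72]; [:: 7; 13; 35; 98];
      [:: 9; 21; 49; 62]; [:: 34; 36; 42; 86]]%N.
Definition label_rep (i : nat) : nat := nth 0 [:: 0; 5; 7; 9; 34]%N i.

(** * Computations on tables *)

Lemma At_ok : [&& closedt mult uvt At, idt \in At, uniq At & size At == 60].
Proof. by vm_compute. Qed.

(** Points outside the five blocks get label 5, the default of [find]; the guard skips them. *)
Lemma At_label :
  all (fun w => all (fun i => (label i < 5) ==>
    (label (nth 0 w i) == label (nth 0 w (label_rep (label i)))) &&
    (label (nth 0 w i) < 5)) (iota 0 100)) At.
Proof. by vm_compute. Qed.

Lemma At_label_faithful :
  all (fun w => all (fun i => label (nth 0 w (label_rep i)) == i) (iota 0 5) ==>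
    (w == idt)) At.
Proof. by vm_compute. Qed.

Lemma eAt_ok : closedt conjt uvt eAt && (j2_et \in eAt).
Proof. by vm_compute. Qed.

Lemma Et_ok : [&& closedt mult eAt Et, idt \in Et, uniq Et & size Et == 32].
Proof. by vm_compute. Qed.

Lemma Et_center :
  [&& j2_zt \in Et, j2_zt != idt &
      all (fun s => compt j2_zt s == compt s j2_zt) Et].
Proof. by vm_compute. Qed.

Lemma Et_extraspecial :
  all (fun s => [&& compt s s \in [:: idt; j2_zt],
    all (fun r => compt s r \in [:: compt r s; compt (compt r s) j2_zt]) Et &
    (s \in [:: idt; j2_zt]) || has (fun r => compt s r != compt r s) Et]) Et.
Proof. by vm_compute. Qed.

Lemma At_Et : all (fun w => (w \in Et) ==> (w == idt)) At.
Proof. by vm_compute. Qed.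

Lemma euvt_cent : all (fun s => compt j2_zt s == compt s j2_zt) euvt.
Proof. by vm_compute. Qed.

Lemma zJ2t_closed : closedt conjt [:: j2_a_table; j2_b_table] (flatten zJ2t).
Proof. by vm_compute. Qed.

Lemma zJ2t_ok :
  [&& uniq (flatten zJ2t), j2_zt \in flatten zJ2t &
      [seq size B | B <- zJ2t] == [:: 1; 10; 32; 32; 80; 160]%N].
Proof. by vm_compute. Qed.

Lemma j2_tt_ok :
  [&& compt j2_zt j2_tt != compt j2_tt j2_zt, j2_tt != idt & compt j2_tt j2_tt == idt].
Proof. by vm_compute. Qed.

Lemma tMt_ok :
  [&& closedt conjt euvt tMt, j2_tt \in tMt, uniq tMt & size tMt == 32].
Proof. by vm_compute. Qed.

(* Unification must not evaluate the tables. *)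
Opaque j2_wordt orbt.

(** * From tables to subgroups of J2 *)

Lemma tab_j2_e : tab j2_e = j2_et. Proof. exact: tab_j2_word. Qed.
Lemma tab_j2_z : tab j2_z = j2_zt. Proof. exact: tab_j2_word. Qed.
Lemma tab_j2_t : tab j2_t = j2_tt. Proof. exact: tab_j2_word. Qed.

Lemma euvt_word s : s \in euvt -> exists2 g, g \in J2 & tab g = s.
Proof.
by rewrite !inE => /or3P[]/eqP->; (eexists; [apply: j2_word_in | apply: tab_j2_word]).
Qed.

Lemma uvt_valid : validt uvt.
Proof. by move=> s uvs; have [g _] := euvt_word (mem_behead (s := euvt) uvs); exists g. Qed.

Lemma euvt_valid : validt euvt.
Proof. by move=> s /euvt_word[g]; exists g. Qed.

Definition A5_J2 : {group 'S_100} := gent uvt.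
Definition E32_J2 : {group 'S_100} := gent eAt.
Definition M_J2 : {group 'S_100} := gent euvt.

Lemma A5_J2_enumt : enumt A5_J2 At.
Proof. have [clA A1 _ _] := and4P At_ok; exact (gent_enumt uvt_valid clA A1). Qed.

Lemma card_A5_J2 : #|A5_J2| = 60.
Proof.
have [_ _ uA /eqP szA] := and4P At_ok; exact (etrans (card_enumt A5_J2_enumt uA) szA).
Qed.

Lemma A5_J2_isog : A5_J2 \isog 'Alt_('I_5).
Proof.
have repP (i : 'I_5) : label_rep i < 100 /\ label (label_rep i) = i.
  by case: i => [[|[|[|[|[|[]]]]]]].
exact (isog_Alt5_enumt A5_J2_enumt repP card_A5_J2 At_label At_label_faithful).
Qed.

Lemma eAt_class : j2_e ^: A5_J2 = [set g | tab g \in eAt].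
Proof.
have [clA A1] := andP eAt_ok; move: clA A1; rewrite /eAt -tab_j2_e => clA A1.
exact (orbt_orbit (to := 'J%act) tabJ uvt_valid clA A1).
Qed.

Lemma eAt_valid : validt eAt.
Proof.
move=> w; rewrite /eAt -tab_j2_e => /(orbtP (to := 'J%act) tabJ uvt_valid)[y _ ->].
by exists y.
Qed.

Lemma E32_J2_enumt : enumt E32_J2 Et.
Proof. have [clE E1 _ _] := and4P Et_ok; exact (gent_enumt eAt_valid clE E1). Qed.

Lemma card_E32_J2 : #|E32_J2| = 32.
Proof.
have [_ _ uE /eqP szE] := and4P Et_ok; exact (etrans (card_enumt E32_J2_enumt uE) szE).
Qed.

Lemma E32_J2_extraspecial : extraspecial E32_J2.
Proof.
have pE : 2.-group E32_J2 by rewrite /pgroup card_E32_J2.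
have [memE _] := E32_J2_enumt.
have gt2 : 2 < #|E32_J2| by rewrite card_E32_J2.
have [] := and3P Et_center; have := Et_extraspecial.
rewrite -tab_j2_z -tab1 (inj_eq tab_inj) -memE tab1 => okE Ez z1 zC.
exact (extraspecial_enumt E32_J2_enumt Ez z1 pE gt2 zC okE).
Qed.

(** Being generated by a full class under [A5_J2], the group is normalised by [A5_J2] with no
    further test. *)
Lemma E32_J2_def : E32_J2 = <<j2_e ^: A5_J2>>%G.
Proof. by apply: val_inj; rewrite /= eAt_class. Qed.

Lemma E32_J2_norm : A5_J2 \subset 'N(E32_J2).
Proof. by rewrite E32_J2_def norms_gen ?class_norm. Qed.

Lemma A5_J2_sub : A5_J2 \subset M_J2.
Proof. exact (gentS (mem_behead (s := euvt))). Qed.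

Lemma E32_J2_sub : E32_J2 \subset M_J2.
Proof.
rewrite E32_J2_def gen_subG class_subG ?A5_J2_sub //.
by apply: mem_gen; rewrite inE tab_j2_e mem_head.
Qed.

Lemma M_J2_cent : M_J2 \subset 'C_J2[j2_z].
Proof.
rewrite gen_subG; apply/subsetP=> g; rewrite inE => gM.
have [h Jh /tab_inj defg] := euvt_word gM; rewrite inE -{1}defg Jh /=.
apply/cent1P; apply: tab_inj; rewrite (tabM g) (tabM j2_z) tab_j2_z.
exact (esym (eqP (allP euvt_cent _ gM))).
Qed.

Lemma E32_A5_sdprod : E32_J2 ><| A5_J2 = E32_J2 <*> A5_J2.
Proof. exact (sdprodEY E32_J2_norm (TI_enumt A5_J2_enumt E32_J2_enumt At_Et)). Qed.

Lemma E32_A5_sub : E32_J2 <*> A5_J2 \subset M_J2.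
Proof. by rewrite join_subG E32_J2_sub A5_J2_sub. Qed.

Lemma card_E32_A5 : #|E32_J2 <*> A5_J2| = (32 * 60)%N.
Proof. by rewrite -(sdprod_card E32_A5_sdprod) card_E32_J2 card_A5_J2. Qed.

(** * The centraliser of z and its maximality *)

Lemma card_J2_factor : #|J2| = (315 * (32 * 60))%N.
Proof.
rewrite card_J2.
(* The factors are rearranged as variables, so that conversion only has to compare small numbers. *)
have e (a b c d f : nat) :
  ((a * b) * (c * d) * (f * f) * 7 = (c * (f * 7)) * (a * (b * (d * f))))%N.
  by rewrite !mulnA (ACl (3 * 5 * 7 * 1 * 2 * 4 * 6)%AC).
exact: (e (2 ^ 5) (2 ^ 2) (3 ^ 2) 3 5)%N.
Qed.

Lemma card_class_z (H : {group 'S_100}) : M_J2 \subset H -> H \subset J2 ->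
  #|j2_z ^: H| \in subsums [:: 1; 10; 32; 32; 80; 160]%N.
Proof.
move=> sMH sHJ; have [uB zB /eqP szB] := and3P zJ2t_ok; rewrite -szB.
have vab : validt [:: j2_a_table; j2_b_table].
  move=> s; rewrite !inE => /orP[]/eqP->; first by exists j2_a; apply: tab_j2_a.
  by exists j2_b; apply: tab_j2_b.
have sHab : H \subset gent [:: j2_a_table; j2_b_table].
  apply: subset_trans sHJ _; apply: genS; apply/subsetP=> g.
  by rewrite !inE => /orP[]/eqP->; rewrite ?tab_j2_a ?tab_j2_b eqxx ?orbT.
have defB : zJ2t = [seq orbt conjt euvt (tab r) | r <- [seq j2_word p 6 | p <- zJ2_words]].
  by rewrite -map_comp; apply: eq_map => p; rewrite /= tab_j2_word.
rewrite -tab_j2_z in zB.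
exact (card_class_subsums euvt_valid vab sMH sHab defB uB zB zJ2t_closed).
Qed.

Lemma subsums_dvd : {in subsums [:: 1; 10; 32; 32; 80; 160]%N, forall d,
  d %| 315 -> d = 1%N \/ d = 315}.
Proof.
have: all (fun d => (d %| 315) ==> (d \in [:: 1; 315]%N))
  (subsums [:: 1; 10; 32; 32; 80; 160]%N) by vm_compute.
by move/allP=> dvd_d d /dvd_d/implyP d_dvd /d_dvd; rewrite !inE => /orP[]/eqP; [left | right].
Qed.

Lemma j2_t_notin : j2_t \notin 'C[j2_z].
Proof.
have [ntz _ _] := and3P j2_tt_ok; apply: contra ntz => /cent1P tz.
by rewrite -tab_j2_z -tab_j2_t -(tabM j2_z) -(tabM j2_t) tz.
Qed.

(** C(z) contains EA of order 1920, so the class size divides 315; being also a partial sum of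
    suborbit lengths, it is 1 or 315. It is not 1, since [j2_t] does not commute with [j2_z]. *)
Lemma card_j2_z_class : #|j2_z ^: J2| = 315.
Proof.
have sMJ : M_J2 \subset J2 := subset_trans M_J2_cent (subsetIl _ _).
have dvd315 : #|j2_z ^: J2| %| 315.
  have := cardSg (subset_trans E32_A5_sub M_J2_cent).
  rewrite card_E32_A5 => /dvdnP[k oC].
  have: (#|'C_J2[j2_z]| * #|j2_z ^: J2|)%N = #|J2|.
    by rewrite -index_cent1 Lagrange ?subsetIl.
  rewrite card_J2_factor oC mulnAC => /eqP; rewrite eqn_pmul2r // => /eqP <-.
  exact: dvdn_mull.
have [o1 |//] := subsums_dvd (card_class_z sMJ (subxx _)) dvd315.
case/negP: j2_t_notin; have: #|J2 : 'C_J2[j2_z]| == 1%N by rewrite index_cent1 o1.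
rewrite indexg_eq1 => /subsetP/(_ j2_t (j2_word_in _ _))/setIP[]; exact.
Qed.

(** Index 315 gives C(z) order 1920, which EA already attains, and [M_J2] lies between the two. *)
Lemma M_J2_eq : E32_J2 <*> A5_J2 = 'C_J2[j2_z] /\ M_J2 = 'C_J2[j2_z]%G.
Proof.
have oC : #|'C_J2[j2_z]| = (32 * 60)%N.
  apply/eqP; rewrite -(eqn_pmul2r (isT : 0 < 315)) -{1}card_j2_z_class.
  by rewrite -index_cent1 Lagrange ?subsetIl // card_J2_factor mulnC.
have sEC := subset_trans E32_A5_sub M_J2_cent.
have defC : E32_J2 <*> A5_J2 = 'C_J2[j2_z].
  by apply/eqP; rewrite eqEcard sEC oC card_E32_A5.
split=> //; apply/group_inj/eqP; rewrite eqEsubset M_J2_cent /= -defC.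
exact: E32_A5_sub.
Qed.

Lemma M_J2_maximal : maximal M_J2 J2.
Proof.
have [_ defM] := M_J2_eq; rewrite defM.
apply: (maximal_cent1 (ds := subsums [:: 1; 10; 32; 32; 80; 160]%N)).
- by move=> H sCH; apply: card_class_z; apply: subset_trans M_J2_cent sCH.
- by rewrite card_j2_z_class; apply: subsums_dvd.
by rewrite card_j2_z_class.
Qed.

Lemma M_J2_shape : shape_2p1p4_A5 M_J2.
Proof.
exists E32_J2, A5_J2; split.
- have [defC defM] := M_J2_eq; rewrite defM /= -defC; exact: E32_A5_sdprod.
- exact: E32_J2_extraspecial.
- exact: card_E32_J2.
exact: A5_J2_isog.
Qed.

Lemma card_j2_t_class : #|j2_t ^: M_J2| = 32.
Proof.
have [+ + + /eqP szT] := and4P tMt_ok; have := szT; rewrite /tMt -tab_j2_t => {}szT clT tT uT.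
exact (etrans (card_orbt (to := 'J%act) tabJ euvt_valid clT tT uT) szT).
Qed.

Lemma order_j2_t : #[j2_t] = 2.
Proof.
have [_] := and3P j2_tt_ok; rewrite -tab_j2_t -tab1 -(tabM j2_t) !(inj_eq tab_inj).
move=> t1 /eqP t2; apply: nt_prime_order => //; exact: t1.
Qed.

Theorem proposition1 :
  exists N : {group 'S_32},
    [/\ [transitive N, on [set: 'I_32] | 'P],
        is_2p1p4_A5 N
      & exists phi : {multiplicative progenitor N -> [subg J2]},
          [/\ forall y : [subg J2], exists x : progenitor N, phi x = y,
              injective (fun s : [subg N] => phi (prog_N s)),
              injective (fun i : 'I_32 => phi (prog_t N i)),
              forall i : 'I_32, #[phi (prog_t N i)] = 2
            & <<[set phi (prog_t N i) | i : 'I_32]>> = [set: [subg J2]]]].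
Proof.
have tM : j2_t \notin M_J2.
  apply: contra j2_t_notin => /(subsetP M_J2_cent); by case/setIP.
have nabJ : ~~ abelian J2.
  apply: contra j2_t_notin => /centsP cJJ; apply/cent1P.
  by apply: cJJ; apply: j2_word_in.
have [N [trN isoN phiP]] := symmetric_generation simple_J2 nabJ M_J2_maximal
  (j2_word_in _ _) tM order_j2_t card_j2_t_class.
exists N; split=> //; exists M_J2; split=> //; first exact: M_J2_maximal.
exact: M_J2_shape.
Qed.
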